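(* Let $S\subseteq\mathbb{N}=\{1,2,3,\ldots\}$, and let $X(S)\subseteq[0,1]$ be the set of all numbers $x$ with an infinite binary expansion $x=\sum_{n=1}^\infty\xi_n2^{-n}$, $\xi_n\in\{0,1\}$, in which $\xi_n=0$ for each $n\notin S$. Then: 1. $\dim_{\mathrm H}X(S)=\underline{\dim}_{\mathrm{MB}}X(S)=\underline{\dim}_{\mathrm B}X(S)=\underline{d}(S)$; 2. $\dim_{\mathrm P}X(S)=\overline{\dim}_{\mathrm{MB}}X(S)=\overline{\dim}_{\mathrm B}X(S)=\bar{d}(S)$.
   Context: The lower and upper densities of $S\subseteq\mathbb{N}$ are $$\underline{d}(S)=\liminf_{N\to\infty}\frac{|S\cap[1,N]|}{N},\qquad \bar{d}(S)=\limsup_{N\to\infty}\frac{|S\cap[1,N]|}{N}.$$ Convention on binary expansions: digit sequences that are eventually $0$ are allowed, so $X(S)=\{\sum_{n\ge1}\xi_n2^{-n} : \xi_n\in\{0,1\}\ \forall n,\ \xi_n=0\ \forall n\notin S\}$. $\dim_{\mathrm H}$ denotes Hausdorff dimension. For a non-empty bounded set $F\subseteq\mathbb{R}$ and $\varepsilon>0$, let $N_\varepsilon(F)$ be the smallest number of sets of diameter at most $\varepsilon$ which can cover $F$. The lower and upper box dimensions are $$\underline{\dim}_{\mathrm B}F=\liminf_{\varepsilon\to0}\frac{\log N_\varepsilon(F)}{-\log\varepsilon},\qquad \overline{\dim}_{\mathrm B}F=\limsup_{\varepsilon\to0}\frac{\log N_\varepsilon(F)}{-\log\varepsilon}.$$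 The modified lower and upper box dimensions are $$\underline{\dim}_{\mathrm{MB}}F=\inf\Big\{\sup_i\underline{\dim}_{\mathrm B}F_i : F\subseteq\bigcup_{i=1}^\infty F_i\Big\},\qquad \overline{\dim}_{\mathrm{MB}}F=\inf\Big\{\sup_i\overline{\dim}_{\mathrm B}F_i : F\subseteq\bigcup_{i=1}^\infty F_i\Big\},$$ the infima being over all countable covers of $F$ by non-empty bounded sets. $\dim_{\mathrm P}$ denotes the standard packing dimension: for $s\ge0$, let $\mathcal{P}^s_\delta(F)$ be the supremum of $\sum_i|B_i|^s$ over countable collections of disjoint balls $B_i$ of radii at most $\delta$ with centers in $F$ ($|B_i|$ being the diameter), $\mathcal{P}^s_0(F)=\lim_{\delta\to0}\mathcal{P}^s_\delta(F)$, $\mathcal{P}^s(F)=\inf\{\sum_i\mathcal{P}^s_0(F_i): F\subseteq\bigcup_{i=1}^\infty F_i\}$, and $\dim_{\mathrm P}F=\inf\{s:\mathcal{P}^s(F)=0\}$. *)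

(* Defs.v *)
From HB Require Import structures.
From mathcomp Require Import all_boot all_order all_algebra.
From mathcomp Require Import finmap.
From mathcomp Require Import all_classical all_reals all_analysis.

Set Implicit Arguments.
Unset Strict Implicit.
Unset Printing Implicit Defensive.

Import Order.TTheory GRing.Theory Num.Theory.
Import numFieldNormedType.Exports.

Local Open Scope classical_set_scope.
Local Open Scope ring_scope.
Local Open Scope ereal_scope.

Section Density.
Context {R : realType}.
Implicit Types S : set nat.

(* |S `&` [1, N]| / N; the value at N = 0 is irrelevant for the limits *)
Definition density_ratio S (N : nat) : \bar R :=
  (#|` fset_set (S `&` [set n | (1 <= n <= N)%N])|%:R / N%:R)%R%:E.

Definition lower_density S : \bar R := limn_einf (density_ratio S).

Definition upper_density S : \bar R := limn_esup (density_ratio S).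

(* The digit xi n has weight 2^-n with n >= 1; xi 0 is not used. Digit
   sequences that are eventually 0 (false) are allowed. *)
Definition digit_set S : set R :=
  [set x | exists xi : nat -> bool,
    (forall n, ~ S n -> xi n = false) /\
    (\sum_(1 <= n < N) ((xi n)%:R / 2 ^+ n : R)%R)%R @[N --> \oo] --> x].

End Density.

Section Dimension.
Context {R : realType}.
Implicit Types (F U : set R) (s delta eps : R).

(* ereal_sup set0 = -oo, hence the max *)
Definition diam U : \bar R :=
  Order.max 0 (ereal_sup [set `|x - y|%R%:E | x in U & y in U]).

(* |U|^s, with |set0|^s = 0 for all s and 0^0 = 1 on singletons *)
Definition diam_pow s U : \bar R :=
  if U == set0 then 0 else poweR (diam U) s.

Definition hausdorff_content s delta F : \bar R :=
  ereal_inf [set \sum_(i <oo) diam_pow s (U i) | U in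
    [set U : nat -> set R |
      (forall i, diam (U i) <= delta%:E) /\ F `<=` \bigcup_i U i]].

Definition hausdorff_measure s F : \bar R :=
  lim (hausdorff_content s delta F @[delta --> 0^'+]).

Definition hausdorff_dim F : \bar R :=
  ereal_inf [set s%:E | s in
    [set s : R | (0 <= s)%R /\ hausdorff_measure s F = 0]].

(* N_eps(F), equal to +oo when no finite cover exists *)
Definition covering_number eps F : \bar R :=
  ereal_inf [set n%:R%:E | n in
    [set n : nat | exists U : 'I_n -> set R,
      (forall i, diam (U i) <= eps%:E) /\ F `<=` \bigcup_i U i]].

Definition box_ratio F eps : \bar R :=
  lne (covering_number eps F) * ((- ln eps)^-1)%R%:E.

Definition lower_box_dim F : \bar R := limf_einf (box_ratio F) 0^'+.

Definition upper_box_dim F : \bar R := limf_esup (box_ratio F) 0^'+.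

Definition bounded_covers F : set (nat -> set R) :=
  [set G | (forall i, G i !=set0 /\ bounded_set (G i)) /\
           F `<=` \bigcup_i G i].

Definition modified_lower_box_dim F : \bar R :=
  ereal_inf [set ereal_sup (range (fun i => lower_box_dim (G i))) | G in
    bounded_covers F].

Definition modified_upper_box_dim F : \bar R :=
  ereal_inf [set ereal_sup (range (fun i => upper_box_dim (G i))) | G in
    bounded_covers F].

(* A countable (possibly finite or empty) family of disjoint closed balls,
   indexed by D: a triple of D, the centers and the radii. *)
Definition packings delta F : set (set nat * (nat -> R) * (nat -> R)) :=
  [set p | let: (D, c, r) := p in
    (forall i, D i -> F (c i) /\ (0 < r i <= delta)%R) /\
    trivIset D (fun i => closed_ball (c i) (r i))].

Definition packing_content s delta F : \bar R :=
  ereal_sup [set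
    (let: (D, c, r) := p in
     \esum_(i in D) diam_pow s (closed_ball (c i) (r i))) | p in
    packings delta F].

Definition packing_premeasure s F : \bar R :=
  lim (packing_content s delta F @[delta --> 0^'+]).

Definition packing_measure s F : \bar R :=
  ereal_inf [set \sum_(i <oo) packing_premeasure s (G i) | G in
    [set G : nat -> set R | F `<=` \bigcup_i G i]].

Definition packing_dim F : \bar R :=
  ereal_inf [set s%:E | s in
    [set s : R | (0 <= s)%R /\ packing_measure s F = 0]].

End Dimension.

(* Main.v *)
Require Import Defs.
From mathcomp Require Import all_boot all_order all_algebra.
From mathcomp Require Import finmap.
From mathcomp Require Import all_classical all_reals all_analysis.
From mathcomp Require Import ring lra zify.

(** Write [a n] for the number of elements of [S] in [[1, n]].

    The upper bounds come from counting and are immediate for the box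
    dimensions: the first [n] digits of a point of the digit set [X] are
    determined by [a n] free ones, so [X] is covered by [2 ^ a n] intervals of
    length [2^-n] (digit_set_dyadic_cover). The same covers bound the Hausdorff
    measure, and [X] itself is an admissible cover for the modified dimensions.

    All lower bounds come from one outer measure. Let [f] be the map from [0, 1)
    to [X] that distributes the binary digits of [t] over the positions in [S]
    (spread_point), and let the mass of [U] be the Lebesgue outer measure of the
    preimage of [U] (digit_mass). Inserting zeros between binary digits does not
    bring integers closer together (spread_expanding); hence parameters whose
    images are within [2^-n] are within [3 * 2^-(a n)] of each other
    (spread_point_expanding), and a set of diameter at most [2^-n] has mass at
    most [3 * 2^-(a n)] (digit_mass_diam). Using [f] in place of a product
    measure on digit sequences leaves Lebesgue measure as the only measure
    involved. The consequences are:

    - A set [G] of positive mass [m] needs at least [m / 3 * 2 ^ a n] sets of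
      diameter [2^-n] to cover it (covering_digit_mass). So its box dimensions
      are at least the densities of [S]. In a countable cover of [X] some set
      has positive mass (cover_digit_mass_gt0), which gives the bounds for the
      modified box dimensions.

    - For [s] below the lower density, the mass of a small set is at most a
      constant times the [s]-th power of its diameter (digit_mass_diam_pow).
      This is the mass distribution principle for the Hausdorff dimension.

    - If the [s]-dimensional packing measure of [X] vanishes, some set of
      positive mass in a cover has finite packing premeasure. Then its covering
      numbers grow at most like the power [- s] of the scale
      (packing_content_cover), which forces [s] to be at least the upper
      density.

    The upper bound of the packing dimension also uses [f]: disjoint balls about
    points of [X] have disjoint preimages, each of which contains a dyadic
    interval of length [2^-(a n)] with [2^-n] comparable to the radius
    (ball_digit_interval), and these lengths add up to at most 1.

    Each of the six dimensions is thus enclosed between equal bounds. *)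

Set Implicit Arguments.
Unset Strict Implicit.
Unset Printing Implicit Defensive.

Import Order.TTheory GRing.Theory Num.Theory.
Import numFieldNormedType.Exports.

Local Open Scope classical_set_scope.
Local Open Scope ring_scope.
Local Open Scope ereal_scope.

(** * Binary words supported on a set of positions *)

Fixpoint digit_count (S : set nat) n : nat :=
  if n is m.+1 then (digit_count S m + (m.+1 \in S))%N else 0%N.

(** The digits of [xi] at the positions of [S] in [[1, n]], read as a binary
    number. *)
Fixpoint compress (S : set nat) (xi : nat -> bool) n : nat :=
  if n is m.+1 then
    if m.+1 \in S then ((compress S xi m).*2 + xi m.+1)%N else compress S xi m
  else 0%N.

(** Puts the digits gathered by [compress] back: the binary digits of [q] move to
    the positions of [S] in [[1, n]], with zeros at the other positions. At
    [n = 0] it is the identity instead of [0], so that surplus leading digits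
    are kept and the map is expanding on all of [nat]. *)
Fixpoint spread (S : set nat) n (q : nat) : nat :=
  if n is m.+1 then
    if m.+1 \in S then ((spread S m q./2).*2 + odd q)%N
    else (spread S m q).*2
  else q.

Section Words.
Implicit Types (S : set nat) (xi : nat -> bool).

Lemma compress_lt S xi n : (compress S xi n < 2 ^ digit_count S n)%N.
Proof.
elim: n => //= n IH; case: ifP => _; last by rewrite addn0.
by rewrite addn1 expnS -addnn; case: (xi _); lia.
Qed.

(** Inserting zeros between the digits of two numbers can only increase their
    distance. *)
Lemma spread_expanding S n q q' :
  (q <= q')%N -> (spread S n q + (q' - q) <= spread S n q')%N.
Proof.
elim: n q q' => [|n IH] q q' qq' /=; first lia.
case: ifP => _; last by have := IH _ _ qq'; lia.
have /IH : (q./2 <= q'./2)%N by exact: half_leq.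
have := odd_double_half q; have := odd_double_half q'.
by rewrite -!addnn; lia.
Qed.

Lemma spread_compressS S xi n : (forall k, ~ S k -> xi k = false) ->
  spread S n.+1 (compress S xi n.+1) =
  ((spread S n (compress S xi n)).*2 + xi n.+1)%N.
Proof.
move=> xiS /=; have [_|/negP nS] := boolP (n.+1 \in S).
  by rewrite [in _./2]addnC half_bit_double oddD odd_double oddb.
by rewrite xiS ?addn0//; move/mem_set.
Qed.

End Words.

Section Expansions.
Context {R : realType}.
Implicit Types (S : set nat) (xi : nat -> bool).

Lemma density_ratioE S n :
  density_ratio S n = ((digit_count S n)%:R / n%:R)%:E :> \bar R.
Proof.
rewrite /density_ratio; congr ((_%:R / _)%:E)%R.
elim: n => [|n IH] /=.
  rewrite (_ : _ `&` _ = set0) ?fset_set0//.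
  by apply/seteqP; split=> // k [_ /=]; lia.
have [nS|nS] := boolP (n.+1 \in S).
  rewrite (_ : S `&` _ = n.+1 |` (S `&` [set k | (1 <= k <= n)%N])); last first.
    apply/seteqP; split=> k /=.
      move=> [Sk kn]; have [->|kn1] := eqVneq k n.+1; first by left.
      by right; split => //; lia.
    move=> [->|[Sk kn]]; first by split; [rewrite inE in nS|lia].
    by split => //; lia.
  have fin : finite_set (S `&` [set k | (1 <= k <= n)%N]).
    by apply: (sub_finite_set _ (finite_II n.+1)) => k [_ /andP[]].
  rewrite fset_setU1// cardfsU1 -IH in_fset_set// addnC.
  rewrite (_ : n.+1 \notin _)//; apply/negP; rewrite inE => -[_ /=]; lia.
rewrite addn0 -IH; congr (#|` fset_set _|); apply/seteqP; split=> k /=.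
  move=> [Sk kn]; split => //; have [kE|kn1] := eqVneq k n.+1; last lia.
  by move: nS; rewrite -kE mem_set.
by move=> [Sk kn]; split => //; lia.
Qed.

Definition partial_value xi n : R :=
  (\sum_(1 <= k < n.+1) ((xi k)%:R / 2 ^+ k))%R.

Lemma partial_valueS xi n :
  partial_value xi n.+1 = (partial_value xi n + (xi n.+1)%:R / 2 ^+ n.+1)%R.
Proof. by rewrite /partial_value big_nat_recr. Qed.

Lemma partial_valueE S xi n : (forall k, ~ S k -> xi k = false) ->
  partial_value xi n = ((spread S n (compress S xi n))%:R / 2 ^+ n)%R.
Proof.
move=> xiS; elim: n => [|n IH]; first by rewrite /partial_value big_geq// mul0r.
rewrite partial_valueS IH spread_compressS// natrD -muln2 natrM.
by rewrite exprS; field; rewrite expf_neq0.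
Qed.

Lemma partial_value_le xi m n : (m <= n)%N ->
  (partial_value xi m <= partial_value xi n)%R.
Proof.
move=> /subnK <-; elim: (n - m)%N => // k IH; apply: (le_trans IH).
by rewrite addSn partial_valueS lerDl divr_ge0.
Qed.

(** The upper ends of the dyadic intervals singled out by longer and longer
    prefixes of an expansion decrease. *)
Lemma partial_value_tail xi m n : (m <= n)%N ->
  (partial_value xi n + (2 ^+ n)^-1 <= partial_value xi m + (2 ^+ m)^-1)%R.
Proof.
move=> /subnK <-; elim: (n - m)%N => // k IH; apply: le_trans IH.
rewrite addSn partial_valueS -addrA lerD2l.
have -> : ((2 ^+ (k + m))^-1 = 2 / 2 ^+ (k + m).+1 :> R)%R.
  by rewrite exprS invfM mulrA divff// mul1r.
rewrite -[X in (_ + X <= _)%R]div1r -mulrDl ler_pM2r ?invr_gt0 ?exprn_gt0//.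
by case: (xi _); rewrite /=; lra.
Qed.

Lemma partial_value_cvg xi : cvgn (partial_value xi).
Proof.
apply: nondecreasing_is_cvgn => [m n|]; first exact: partial_value_le.
exists (partial_value xi 0 + (2 ^+ 0)^-1)%R => _ [n _ <-].
by apply: le_trans (partial_value_tail xi (leq0n n)); rewrite lerDl invr_ge0.
Qed.

(** The digits beyond [n] are worth at most [2^-n], so the first [n] digits
    place the number in a closed dyadic interval. *)
Lemma expansion_cell S xi n (x : R) : (forall k, ~ S k -> xi k = false) ->
  partial_value xi @ \oo --> x ->
  ((spread S n (compress S xi n))%:R / 2 ^+ n <= x <=
   (spread S n (compress S xi n)).+1%:R / 2 ^+ n)%R.
Proof.
move=> xiS /cvg_lim <-//.
rewrite -[(spread _ _ _).+1%:R]natr1 mulrDl -partial_valueE// div1r.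
apply/andP; split.
  apply: limr_ge; first exact: partial_value_cvg.
  by exists n => // m /= nm; exact: partial_value_le.
apply: limr_le; first exact: partial_value_cvg.
exists n => // m /= nm; apply: le_trans (partial_value_tail xi nm).
by rewrite lerDl invr_ge0.
Qed.

(** The sums of [partial_value] include their upper index, those of [digit_set]
    do not. *)
Lemma digit_setP S (x : R) : digit_set S x <->
  exists xi, (forall k, ~ S k -> xi k = false) /\ partial_value xi @ \oo --> x.
Proof.
have shift xi : (partial_value xi @ \oo --> x) =
    ((\sum_(1 <= n < N) ((xi n)%:R / 2 ^+ n : R)%R)%R @[N --> \oo] --> x).
  by rewrite -[RHS]cvg_shiftS.
by split=> -[xi [xiS cx]]; exists xi; split; rewrite // ?shift// -shift.
Qed.

End Expansions.

(** * Distributing the digits of a parameter *)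

Section Spreading.
Context {R : realType}.
Variable S : set nat.
Implicit Types (t x : R).

Lemma trunc_double t : (0 <= t)%R -> (Num.trunc (2 * t))./2 = Num.trunc t.
Proof.
move=> t0; have /andP[] := truncn_itv t0.
set m := Num.trunc t => m1 m2.
have : (m.*2 <= Num.trunc (2 * t) < m.*2.+2)%N.
  rewrite truncn_ge_nat ?mulr_ge0// truncn_lt_nat ?mulr_ge0//.
  rewrite -doubleS -!muln2 !natrM; lra.
by have := odd_double_half (Num.trunc (2 * t)); rewrite -!addnn; lia.
Qed.

(** The [k]-th binary digit of [t] is the parity of the integral part of
    [2 ^+ k * t]. The digits of [t] are handed out to the positions of [S] in
    increasing order. *)
Definition spread_digits t k :=
  (k \in S) && odd (Num.trunc (2 ^+ digit_count S k * t)).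

Definition spread_point t : R := limn (partial_value (spread_digits t)).

Lemma spread_digits_out t k : ~ S k -> spread_digits t k = false.
Proof. by move=> nS; rewrite /spread_digits memNset. Qed.

Lemma compress_spread_digits t n : (0 <= t < 1)%R ->
  compress S (spread_digits t) n = Num.trunc (2 ^+ digit_count S n * t).
Proof.
move=> /andP[t0 t1]; elim: n => [|n IH].
  by rewrite mul1r; apply/esym/truncn0Pn; rewrite -ltNge.
rewrite /= IH /spread_digits /=; case: (_ \in _); last by rewrite addn0.
rewrite addn1 exprS -mulrA /= -[in RHS](odd_double_half (Num.trunc (2 * _))).
by rewrite trunc_double ?mulr_ge0 ?exprn_ge0// addnC.
Qed.

Lemma spread_point_in t : digit_set S (spread_point t).
Proof.
apply/digit_setP; exists (spread_digits t); split.
  exact: spread_digits_out.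
exact: partial_value_cvg.
Qed.

Lemma spread_point_cell n t : (0 <= t < 1)%R ->
  ((spread S n (Num.trunc (2 ^+ digit_count S n * t)))%:R / 2 ^+ n <=
   spread_point t <=
   (spread S n (Num.trunc (2 ^+ digit_count S n * t))).+1%:R / 2 ^+ n)%R.
Proof.
move=> t01; rewrite -compress_spread_digits//.
apply: expansion_cell; first exact: spread_digits_out.
exact: partial_value_cvg.
Qed.

(** If two images are within [2^-n], their first [n] digits read as integers
    differ by at most 2; so do, by [spread_expanding], the integers formed by
    the leading [digit_count S n] digits of the parameters. *)
Lemma spread_point_expanding n t t' : (0 <= t < 1)%R -> (0 <= t' < 1)%R ->
  (`|spread_point t - spread_point t'| <= (2 ^+ n)^-1)%R ->
  (`|t - t'| <= 3 / 2 ^+ digit_count S n)%R.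
Proof.
wlog tt' : t t' / (t <= t')%R.
  move=> H h1 h2 h3; have [?|/ltW ?] := leP t t'; first exact: H.
  by rewrite distrC; apply: H => //; rewrite distrC.
move=> h h'.
have := spread_point_cell n h; have := spread_point_cell n h'.
set a := digit_count S n; set q' := Num.trunc (2 ^+ a * t').
set q := Num.trunc (2 ^+ a * t) => /andP[c1' _] /andP[_ c2] close.
have a0 : (0 < 2 ^+ a :> R)%R by rewrite exprn_gt0.
have n0 : (0 < 2 ^+ n :> R)%R by rewrite exprn_gt0.
have qq' : (q <= q')%N by apply: le_truncn; rewrite ler_pM2l.
have exp := spread_expanding S n qq'.
have {}close : ((spread S n q')%:R - (spread S n q).+1%:R <= 1 :> R)%R.
  rewrite -(@ler_pM2r _ (2 ^+ n)^-1)%R ?invr_gt0// mul1r mulrBl.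
  have := ler_norml (spread_point t - spread_point t') (2 ^+ n)^-1.
  by rewrite close => /esym/andP[]; lra.
have {exp}close : (q' <= q + 2)%N.
  move: close; rewrite lerBlDl natr1 ler_nat; lia.
have /truncn_itv/andP[+ _] : (0 <= 2 ^+ a * t)%R.
  by rewrite mulr_ge0 ?exprn_ge0//; case/andP: h.
have := truncnS_gt (2 ^+ a * t'); rewrite -/q -/q' => u' u.
rewrite distrC ger0_norm ?subr_ge0// ler_pdivlMr// mulrBl ![(_ * 2 ^+ _)%R]mulrC.
have : (q'.+1%:R <= (q + 3)%:R :> R)%R by rewrite ler_nat; lia.
by rewrite natrD; lra.
Qed.

(** A point of the digit set lies in the same closed dyadic interval of length
    [2^-n] as the images of all parameters that begin with its [S]-digits, and
    these parameters fill a dyadic interval. *)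
Lemma digit_set_cell n x : digit_set S x ->
  exists q, [/\ (q < 2 ^ digit_count S n)%N,
    ((spread S n q)%:R / 2 ^+ n <= x <= (spread S n q).+1%:R / 2 ^+ n)%R &
    forall t, (q%:R / 2 ^+ digit_count S n <= t <
               q.+1%:R / 2 ^+ digit_count S n)%R ->
      (`|spread_point t - x| <= (2 ^+ n)^-1)%R].
Proof.
move=> /digit_setP[xi [xiS cx]]; have xcell := expansion_cell n xiS cx.
have qlt := compress_lt S xi n.
move: xcell qlt; set q := compress S xi n; set a := digit_count S n => xcell qlt.
exists q; split => // t /andP[t1 t2].
have a0 : (0 < 2 ^+ a :> R)%R by rewrite exprn_gt0.
have t01 : (0 <= t < 1)%R.
  apply/andP; split; first by apply: le_trans t1; rewrite divr_ge0// ltW.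
  apply: (lt_le_trans t2).
  by rewrite ler_pdivrMr// mul1r -natrX ler_nat.
have := spread_point_cell n t01.
rewrite (_ : Num.trunc _ = q); last first.
  apply: truncn_def; move: t1 t2; rewrite ler_pdivrMr// ltr_pdivlMr//.
  by rewrite mulrC => -> ->.
have n0 : (0 < 2 ^+ n :> R)%R by rewrite exprn_gt0.
move: xcell; rewrite -[(spread _ _ _).+1%:R]natr1 mulrDl div1r.
by move=> /andP[? ?] /andP[? ?]; rewrite ler_norml; lra.
Qed.

End Spreading.

(** * Diameters and the mass of a set *)

Section Diameter.
Context {R : realType}.
Implicit Types (U : set R) (e : R).

Lemma diam_leP U e : (0 <= e)%R ->
  (diam U <= e%:E <-> forall x y, U x -> U y -> (`|x - y| <= e)%R).
Proof.
move=> e0; rewrite /diam ge_max lee_fin e0 /=; split=> [H x y Ux Uy|H].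
  rewrite -lee_fin; apply: le_trans H; apply: ereal_sup_ubound.
  by exists x => //; exists y.
by apply: ge_ereal_sup => _ [x Ux [y Uy <-]]; rewrite lee_fin; exact: H.
Qed.

Lemma diam_ge0 U : 0 <= diam U.
Proof. by rewrite /diam le_max lexx. Qed.

Lemma diam_set0 : diam (set0 : set R) = 0.
Proof.
by apply/eqP; rewrite eq_le diam_ge0 andbT; apply/diam_leP.
Qed.

End Diameter.

Section LebesgueOuter.
Context {R : realType}.
Implicit Types (A B : set R).

(** [lebesgue_measure] is defined on all sets as the outer measure that extends
    the length of intervals, which makes it monotone and countably subadditive
    on arbitrary sets. *)
Lemma lebesgue_outer_le A B : A `<=` B ->
  lebesgue_measure A <= lebesgue_measure B.
Proof. exact: (le_outer_measure (mu_ext (@wlength R idfun))). Qed.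

Lemma lebesgue_outer_bigcup (A : nat -> set R) :
  lebesgue_measure (\bigcup_i A i) <= \sum_(i <oo) lebesgue_measure (A i).
Proof. exact: (outer_measure_sigma_subadditive (mu_ext (@wlength R idfun))). Qed.

Lemma lebesgue_outer_ge0 A : 0 <= lebesgue_measure A.
Proof. exact: outer_measure_ge0. Qed.

Lemma lebesgue_outer_diam A (r : R) : (0 <= r)%R ->
  (forall x y, A x -> A y -> (`|x - y| <= r)%R) ->
  lebesgue_measure A <= r%:E.
Proof.
move=> r0 Ar; have [->|/set0P[x0 Ax0]] := eqVneq A set0.
  by rewrite measure0 lee_fin.
have lbA : has_inf A.
  split; first by exists x0.
  by exists (x0 - r)%R => x Ax; have := Ar _ _ Ax0 Ax; rewrite ler_norml; lra.
have /le_trans : lebesgue_measure A <=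
    lebesgue_measure ([set` `[inf A, (inf A + r)%R]] : set R).
  apply: lebesgue_outer_le => x Ax /=; rewrite in_itv/= ge_inf//=; last first.
    exact: (proj2 lbA).
  rewrite -lerBlDr; apply: lb_le_inf => [|y Ay]; first by exists x0.
  by have := Ar _ _ Ax Ay; rewrite ler_norml; lra.
apply; rewrite lebesgue_measure_itv /= lte_fin.
case: ifP => _; last by rewrite lee_fin.
by rewrite -EFinB lee_fin; lra.
Qed.

End LebesgueOuter.

Section DigitMass.
Context {R : realType}.
Variable S : set nat.
Implicit Types (F G U : set R).

(** The outer measure induced by the uniform distribution on the digit set, in
    which the digits at positions in [S] are independent fair coin flips: the
    push-forward of Lebesgue outer measure by [spread_point]. *)
Definition digit_mass U : \bar R :=
  lebesgue_measure [set t : R | (0 <= t < 1)%R /\ U (spread_point S t)].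

Lemma digit_mass_ge0 U : 0 <= digit_mass U.
Proof. exact: lebesgue_outer_ge0. Qed.

Lemma digit_mass0 : digit_mass set0 = 0.
Proof.
rewrite /digit_mass [X in lebesgue_measure X](_ : _ = set0) ?measure0//.
by apply/seteqP; split => // t [].
Qed.

Lemma digit_mass_sub F (U : nat -> set R) : F `<=` \bigcup_i U i ->
  digit_mass F <= \sum_(i <oo) digit_mass (U i).
Proof.
move=> FU; apply: le_trans (lebesgue_outer_bigcup _).
apply: lebesgue_outer_le => t [t01 /FU [i _ Ui]].
by exists i.
Qed.

Lemma digit_mass_le1 U : digit_mass U <= 1.
Proof.
apply: lebesgue_outer_diam => // x y [/andP[? ?] _] [/andP[? ?] _].
by rewrite ler_norml; lra.
Qed.

Lemma digit_mass_digit_set : digit_mass (digit_set S) = 1.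
Proof.
rewrite /digit_mass [X in lebesgue_measure X](_ : _ = `[0%R, 1%R[%classic).
  by rewrite lebesgue_measure_itv /= lte_fin ltr01 sube0.
apply/seteqP; split => t /=; rewrite in_itv/=; first by case.
by move=> t01; split => //; exact: spread_point_in.
Qed.

Lemma digit_mass_diam n U : diam U <= ((2 ^+ n)^-1)%R%:E ->
  digit_mass U <= (3 / 2 ^+ digit_count S n)%R%:E.
Proof.
have n0 : (0 <= (2 ^+ n)^-1 :> R)%R by rewrite invr_ge0 exprn_ge0.
move=> /(diam_leP _ n0) Un; apply: lebesgue_outer_diam => [|x y [x01 Ux] [y01 Uy]].
  by rewrite divr_ge0// exprn_ge0.
by apply: spread_point_expanding => //; exact: Un.
Qed.

(** The finite cover is padded with empty sets to a sequence. *)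
Lemma digit_mass_finite_cover n F (U : 'I_n -> set R) (b : R) :
  F `<=` \bigcup_i U i -> (forall i, digit_mass (U i) <= b%:E) ->
  digit_mass F <= (n%:R * b)%R%:E.
Proof.
move=> FU Ub; pose V k := if insub k is Some i then U i else set0.
have : F `<=` \bigcup_k V k.
  by move=> x /FU[i _ Ux]; exists (val i) => //; rewrite /V valK.
move=> /digit_mass_sub /le_trans; apply.
rewrite (nneseries_split _ n) => [|k _]; last exact: digit_mass_ge0.
rewrite eseries0 ?adde0 => [|k nk _]; last first.
  by rewrite /V insubF ?digit_mass0// ltnNge -(add0n n) nk.
rewrite add0n big_mkord; apply: (@le_trans _ _ (\sum_(k < n) b%:E)).
  by apply: lee_sum => k _; rewrite /V valK.
by rewrite sumEFin lee_fin sumr_const card_ord mulr_natl.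
Qed.

(** Countable subadditivity forces some piece of a countable cover to carry
    mass. *)
Lemma cover_digit_mass_gt0 (G : nat -> set R) :
  digit_set S `<=` \bigcup_i G i -> exists i, 0 < digit_mass (G i).
Proof.
move=> /digit_mass_sub; rewrite digit_mass_digit_set => XG.
apply: contrapT => /forallNP G0.
move: XG; rewrite eseries0; first by rewrite lee_fin ler10.
move=> i _ _; apply/eqP; rewrite eq_le digit_mass_ge0 andbT leNgt.
exact/negP.
Qed.

(** Each set of the cover carries mass at most [3 / 2 ^+ digit_count S k]. Up to
    the factor, a set of positive mass is thus as hard to cover as the whole
    digit set. *)
Lemma covering_digit_mass n k G (U : 'I_n -> set R) :
  (forall i, diam (U i) <= ((2 ^+ k)^-1)%R%:E) -> G `<=` \bigcup_i U i ->
  (fine (digit_mass G) / 3 * 2 ^+ digit_count S k <= n%:R)%R.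
Proof.
move=> Uk GU; have := digit_mass_finite_cover GU (fun i => digit_mass_diam (Uk i)).
have a0 : (0 < 2 ^+ digit_count S k :> R)%R by rewrite exprn_gt0.
rewrite -[digit_mass G]fineK ?ge0_fin_numE ?digit_mass_ge0//; last first.
  by rewrite (le_lt_trans (digit_mass_le1 _))// ltry.
by rewrite lee_fin mulrA ler_pdivlMr// => ?; lra.
Qed.

End DigitMass.

(** * Inferior and superior limits along a filter *)

Section LimitBounds.
Context {R : realType} {T : choiceType} {X : filteredType T}.
Variables (F : set_system X).
Context {FF : Filter F}.
Implicit Types (f : X -> \bar R) (r : \bar R).

Lemma limf_einf_gt f r : r < limf_einf f F -> \forall x \near F, r < f x.
Proof.
rewrite limf_einfE => /ereal_sup_gt[_ [A FA <-]] rA.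
apply: filterS FA => x Ax; apply: (lt_le_trans rA).
by apply: ereal_inf_lbound; exists x.
Qed.

Lemma limf_esup_lt f r : limf_esup f F < r -> \forall x \near F, f x < r.
Proof.
rewrite limf_esupE => /ereal_inf_lt[_ [A FA <-]] rA.
apply: filterS FA => x Ax; apply: le_lt_trans rA.
by apply: ereal_sup_ubound; exists x.
Qed.

Lemma limf_einf_ge f r : (\forall x \near F, r <= f x) -> r <= limf_einf f F.
Proof.
move=> Ff; rewrite limf_einfE.
apply: le_trans (ereal_sup_ubound _); last by exists [set x | r <= f x].
by apply: le_ereal_inf_tmp => _ [x rx <-].
Qed.

Lemma limf_esup_le f r : (\forall x \near F, f x <= r) -> limf_esup f F <= r.
Proof.
move=> Ff; rewrite limf_esupE.
apply: (le_trans (ereal_inf_lbound _)); first by exists [set x | f x <= r].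
by apply: ge_ereal_sup => _ [x rx <-].
Qed.

Lemma limf_einf_lt f r : limf_einf f F < r ->
  forall A, F A -> exists2 x, A x & f x < r.
Proof.
rewrite limf_einfE => Fr A FA.
have : ereal_inf (f @` A) < r.
  by apply: le_lt_trans Fr; apply: ereal_sup_ubound; exists A.
by move=> /ereal_inf_lt[_ [x Ax <-] ?]; exists x.
Qed.

Lemma limf_esup_gt f r : r < limf_esup f F ->
  forall A, F A -> exists2 x, A x & r < f x.
Proof.
rewrite limf_esupE => Fr A FA.
have : r < ereal_sup (f @` A).
  by apply: (lt_le_trans Fr); apply: ereal_inf_lbound; exists A.
by move=> /ereal_sup_gt[_ [x Ax <-] ?]; exists x.
Qed.

Lemma limf_einf_le_frequently f r :
  (forall A, F A -> exists2 x, A x & f x <= r) -> limf_einf f F <= r.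
Proof.
move=> Fr; rewrite limf_einfE; apply: ge_ereal_sup => _ [A /Fr[x Ax fx] <-].
by apply: le_trans fx; apply: ereal_inf_lbound; exists x.
Qed.

Lemma limf_esup_ge_frequently f r :
  (forall A, F A -> exists2 x, A x & r <= f x) -> r <= limf_esup f F.
Proof.
move=> Fr; rewrite limf_esupE; apply: le_ereal_inf_tmp => _ [A /Fr[x Ax fx] <-].
by apply: (le_trans fx); apply: ereal_sup_ubound; exists x.
Qed.

End LimitBounds.

Section RealApproximation.
Context {R : realType}.
Implicit Types (x y : \bar R) (s : R).

Lemma lte_real_dense x y : x < y -> exists s, x < s%:E < y.
Proof.
case: x y => [a||] [b||]//=.
- by rewrite lte_fin => ab; exists ((a + b) / 2)%R; rewrite !lte_fin; lra.
- by move=> _; exists (a + 1)%R; rewrite lte_fin ltry; lra.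
- by move=> _; exists (b - 1)%R; rewrite lte_fin ltNyr; lra.
- by move=> _; exists 0%R; rewrite ltNyr ltry.
Qed.

Lemma lee_real_below x y : (forall s, s%:E < x -> s%:E <= y) -> x <= y.
Proof.
move=> H; rewrite leNgt; apply/negP => /lte_real_dense[s /andP[ys sx]].
by have := H _ sx; rewrite leNgt ys.
Qed.

Lemma lee_real_above x y : (forall s, y < s%:E -> x <= s%:E) -> x <= y.
Proof.
move=> H; rewrite leNgt; apply/negP => /lte_real_dense[s /andP[ys sx]].
by have := H _ ys; rewrite leNgt sx.
Qed.

End RealApproximation.

(** * Dyadic scales *)

Section DyadicScales.
Context {R : realType}.
Implicit Types (s c eps : R).

(** An arbitrarily small gap between exponents absorbs every constant factor at
    fine scales; all the estimates below lose only such factors. *)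
Lemma powR2_dominates s s' c : (s < s')%R -> (0 < c)%R ->
  \forall k \near \oo, (2 `^ (s * k%:R) <= c * 2 `^ (s' * k%:R))%R.
Proof.
move=> ss' c0; have l0 : (0 < ln 2 :> R)%R by rewrite ln_gt0// ltr1n.
near=> k; rewrite -{1}(lnK c0) /powR pnatr_eq0 /= -expRD ler_expR.
have : (- ln c / ((s' - s) * ln 2) <= k%:R)%R.
  by near: k; exact: nbhs_infty_ger.
rewrite ler_pdivrMr ?mulr_gt0 ?subr_gt0//.
by rewrite !mulrA -mulrA => ?; lra.
Unshelve. all: by end_near. Qed.

Lemma dyadic_scale eps K : (0 < eps)%R -> (eps <= (2 ^+ K)^-1)%R ->
  exists k, [/\ (K <= k)%N, ((2 ^+ k.+1)^-1 < eps)%R & (eps <= (2 ^+ k)^-1)%R].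
Proof.
move=> e0 eK.
have ex : exists k, ((2 ^+ k.+1)^-1 < eps)%R.
  exists (Num.trunc eps^-1); rewrite invf_plt ?posrE ?exprn_gt0//.
  apply: (lt_le_trans (truncnS_gt _)).
  by rewrite -natrX ler_nat ltnW// ltn_expl.
case: (ex_minnP ex) => k ke kmin.
have Kk : (K <= k)%N.
  have := lt_le_trans ke eK; rewrite ltf_pV2 ?posrE ?exprn_gt0//.
  by rewrite ltr_eXn2l ?ltr1n.
exists k; split => //; rewrite leNgt; apply/negP.
case: k ke kmin Kk => [|k] ke kmin Kk ek.
  by have := lt_le_trans ek eK; move: Kk; rewrite leqn0 => /eqP ->; rewrite ltxx.
by have := kmin _ ek; rewrite ltnn.
Qed.

Lemma dyadic_at_right (A : set R) : 0^'+ A ->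
  \forall k \near \oo, A (2 ^+ k)^-1%R.
Proof.
move=> [e /= e0 eA]; near=> k; apply: eA => /=; last by rewrite invr_gt0 exprn_gt0.
rewrite sub0r normrN gtr0_norm ?invr_gt0 ?exprn_gt0//.
rewrite invf_plt ?posrE ?exprn_gt0//.
apply: (@le_lt_trans _ _ k%:R); first by near: k; exact: nbhs_infty_ger.
by rewrite -natrX ltr_nat ltn_expl.
Unshelve. all: by end_near. Qed.

Lemma ler_powRN_scale s eps k : (0 <= s)%R -> (0 < eps)%R ->
  ((2 ^+ k)^-1 <= eps)%R -> (eps `^ (- s) <= 2 `^ (s * k%:R))%R.
Proof.
move=> s0 e0 ke; rewrite /powR !gt_eqF//= ler_expR.
have : (ln (2 ^+ k)^-1 <= ln eps)%R.
  by rewrite ler_ln ?posrE ?invr_gt0 ?exprn_gt0.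
rewrite lnV ?posrE ?exprn_gt0// lnXn// -mulr_natl => {}ke.
by rewrite mulNr -mulrN -mulrA ler_wpM2l//; lra.
Qed.

Lemma ler_scale_powRN s eps k : (0 <= s)%R -> (0 < eps)%R ->
  (eps <= (2 ^+ k)^-1)%R -> (2 `^ (s * k%:R) <= eps `^ (- s))%R.
Proof.
move=> s0 e0 ke; rewrite /powR !gt_eqF//= ler_expR.
have : (ln eps <= ln (2 ^+ k)^-1)%R.
  by rewrite ler_ln ?posrE ?invr_gt0 ?exprn_gt0.
rewrite lnV ?posrE ?exprn_gt0// lnXn// -mulr_natl => {}ke.
by rewrite mulNr -mulrN -mulrA ler_wpM2l//; lra.
Qed.

End DyadicScales.

(** * Densities as growth rates of the number of cells *)

Section DigitDensity.
Context {R : realType}.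
Variable S : set nat.
Implicit Types (s c : R).

(** The next four lemmas turn a strict bound on a density into a comparison of
    [2 ^+ digit_count S k] with a power of the scale, with a constant factor of
    one's choice. They hold for all large [k] or for arbitrarily large [k],
    according to the kind of limit. *)
Lemma lower_density_gt s c : s%:E < lower_density S -> (0 < c)%R ->
  \forall k \near \oo, (2 `^ (s * k%:R) <= c * 2 ^+ digit_count S k)%R.
Proof.
move=> /lte_real_dense[s' /andP[ss' s'S]] c0; rewrite lte_fin in ss'.
have dom := powR2_dominates ss' c0.
near=> k; apply: (@le_trans _ _ (c * 2 `^ (s' * k%:R))%R); first by near: k.
rewrite ler_pM2l// -powR_mulrn// ler_powR ?ler1n//.
have k0 : (0 < k)%N by near: k; exact: nbhs_infty_gt.
rewrite -ler_pdivlMr ?ltr0n// -lee_fin -density_ratioE ltW//.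
by near: k; exact: (limf_einf_gt s'S).
Unshelve. all: by end_near. Qed.

Lemma upper_density_lt s c : upper_density S < s%:E -> (0 < c)%R ->
  \forall k \near \oo, (2 ^+ digit_count S k <= c * 2 `^ (s * k%:R))%R.
Proof.
move=> /lte_real_dense[s' /andP[s'S s's]] c0; rewrite lte_fin in s's.
have dom := powR2_dominates s's c0.
near=> k; apply: (@le_trans _ _ (2 `^ (s' * k%:R))%R); last by near: k.
rewrite -powR_mulrn// ler_powR ?ler1n//.
have k0 : (0 < k)%N by near: k; exact: nbhs_infty_gt.
rewrite -ler_pdivrMr ?ltr0n// -lee_fin -density_ratioE ltW//.
by near: k; exact: (limf_esup_lt s'S).
Unshelve. all: by end_near. Qed.

Lemma lower_density_lt s c (A : set nat) : lower_density S < s%:E -> (0 < c)%R ->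
  \oo A -> exists2 k, A k & (2 ^+ digit_count S k <= c * 2 `^ (s * k%:R))%R.
Proof.
move=> /lte_real_dense[s' /andP[s'S s's]] c0 FA; rewrite lte_fin in s's.
have [k] := limf_einf_lt s'S (filterI FA (filterI (nbhs_infty_gt 0)
  (powR2_dominates s's c0))).
move=> [Ak [/= k0 dom]]; rewrite density_ratioE lte_fin ltr_pdivrMr ?ltr0n// => ks.
exists k => //; apply: le_trans dom.
by rewrite -powR_mulrn// ler_powR ?ler1n// ltW.
Qed.

Lemma upper_density_gt s c (A : set nat) : s%:E < upper_density S -> (0 < c)%R ->
  \oo A -> exists2 k, A k & (2 `^ (s * k%:R) <= c * 2 ^+ digit_count S k)%R.
Proof.
move=> /lte_real_dense[s' /andP[ss' s'S]] c0 FA; rewrite lte_fin in ss'.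
have [k] := limf_esup_gt s'S (filterI FA (filterI (nbhs_infty_gt 0)
  (powR2_dominates ss' c0))).
move=> [Ak [/= k0 dom]]; rewrite density_ratioE lte_fin ltr_pdivlMr ?ltr0n// => ks.
exists k => //; apply: (le_trans dom).
by rewrite ler_pM2l// -powR_mulrn// ler_powR ?ler1n// ltW.
Qed.

Lemma lower_density_ge0 : 0 <= lower_density S :> \bar R.
Proof.
apply: limf_einf_ge; apply: nearW => n.
by rewrite density_ratioE lee_fin divr_ge0.
Qed.

Lemma upper_density_ge0 : 0 <= upper_density S :> \bar R.
Proof. exact: le_trans lower_density_ge0 (limn_einf_sup _). Qed.

End DigitDensity.

(** * Box dimensions *)

Lemma dyadic_powRN {R : realType} (s : R) k :
  ((2 ^+ k)^-1 `^ (- s) = 2 `^ (s * k%:R))%R.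
Proof. by rewrite -powR_mulrn// -powRN -powRrM mulrNN mulrC. Qed.

Section BoxRatio.
Context {R : realType}.
Implicit Types (F : set R) (s eps : R).

Lemma box_ratio_ge F s eps : (0 < eps < 1)%R ->
  (eps `^ (- s))%:E <= covering_number eps F -> s%:E <= box_ratio F eps.
Proof.
move=> /andP[e0 e1] eN; have l0 : (0 < - ln eps)%R by rewrite oppr_gt0 ln_lt0 ?e0.
have sE : (ln (eps `^ (- s)) = s * - ln eps)%R by rewrite ln_powR mulNr mulrN.
rewrite /box_ratio lee_pdivlMr// -EFinM -sE -lne_EFin ?powR_gt0//.
have p0 : 0 <= (eps `^ (- s))%:E by rewrite lee_fin powR_ge0.
by rewrite lee_lne// in_itv/= leey andbT// (le_trans p0).
Qed.

Lemma box_ratio_le F s eps : (0 < eps < 1)%R ->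
  covering_number eps F <= (eps `^ (- s))%:E -> box_ratio F eps <= s%:E.
Proof.
move=> /andP[e0 e1] eN; have l0 : (0 < - ln eps)%R by rewrite oppr_gt0 ln_lt0 ?e0.
have sE : (ln (eps `^ (- s)) = s * - ln eps)%R by rewrite ln_powR mulNr mulrN.
rewrite /box_ratio lee_pdivrMr// -EFinM -sE -lne_EFin ?powR_gt0//.
have p0 : 0 <= (eps `^ (- s))%:E by rewrite lee_fin powR_ge0.
rewrite lee_lne// in_itv/= leey andbT//.
by apply: le_ereal_inf_tmp => _ [n _ <-]; rewrite lee_fin.
Qed.

Lemma covering_number_le eps F n (U : 'I_n -> set R) :
  (forall i, diam (U i) <= eps%:E) -> F `<=` \bigcup_i U i ->
  covering_number eps F <= n%:R%:E.
Proof. by move=> Ue FU; apply: ereal_inf_lbound; exists n => //; exists U. Qed.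

Lemma covering_number_anti eps eps' F : (eps <= eps')%R ->
  covering_number eps' F <= covering_number eps F.
Proof.
move=> ee'; apply: le_ereal_inf_tmp => _ [n [U [Ue FU]] <-].
apply: covering_number_le FU => i; apply: (le_trans (Ue i)).
by rewrite lee_fin.
Qed.

Lemma covering_number_ge1 eps F : F !=set0 -> 1 <= covering_number eps F.
Proof.
move=> [x Fx]; apply: le_ereal_inf_tmp => _ [[|n] [U [_ FU]] <-].
  by have [[]] := FU _ Fx.
by rewrite lee_fin ler1n.
Qed.

End BoxRatio.

Section BoxDimensions.
Context {R : realType}.
Variable S : set nat.
Implicit Types (F G : set R) (s eps : R).

(** The first [n] digits of a point of the digit set at the positions in [S]
    determine the dyadic interval of length [2^-n] that contains it. *)
Lemma digit_set_dyadic_cover n : exists U : 'I_(2 ^ digit_count S n) -> set R,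
  (forall i, diam (U i) <= ((2 ^+ n)^-1)%R%:E) /\
  digit_set S `<=` \bigcup_i U i.
Proof.
exists (fun i => [set x | ((spread S n i)%:R / 2 ^+ n <= x <=
                           (spread S n i).+1%:R / 2 ^+ n)%R]); split => [i|x Xx].
  apply/diam_leP => [|x y]; first by rewrite invr_ge0 exprn_ge0.
  rewrite /= -[(spread _ _ _).+1%:R]natr1 mulrDl div1r.
  by move=> /andP[? ?] /andP[? ?]; rewrite ler_norml; lra.
have [q [qn xq _]] := digit_set_cell n Xx.
by exists (Ordinal qn).
Qed.

Lemma covering_number_digit_set_le n :
  covering_number (2 ^+ n)^-1 (digit_set S : set R) <= (2 ^ digit_count S n)%:R%:E.
Proof.
by have [U [Un XU]] := digit_set_dyadic_cover n; exact: covering_number_le XU.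
Qed.

Lemma covering_number_digit_mass G k eps : (eps <= (2 ^+ k)^-1)%R ->
  (fine (digit_mass S G) / 3 * 2 ^+ digit_count S k)%:E <= covering_number eps G.
Proof.
move=> ek; apply: le_ereal_inf_tmp => _ [n [U [Ue GU]] <-].
rewrite lee_fin; apply: covering_digit_mass GU => i.
by apply: (le_trans (Ue i)); rewrite lee_fin.
Qed.

Lemma fine_digit_mass_gt0 G : 0 < digit_mass S G -> (0 < fine (digit_mass S G))%R.
Proof.
by move=> G0; rewrite fine_gt0// G0 (le_lt_trans (digit_mass_le1 _ _))// ltry.
Qed.

Lemma digit_mass_nonempty G : 0 < digit_mass S G -> G !=set0.
Proof.
by move=> G0; apply/set0P/negP => /eqP G00; move: G0; rewrite G00 digit_mass0 ltxx.
Qed.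

Lemma lower_box_dim_ge0 F : F !=set0 -> 0 <= lower_box_dim F.
Proof.
move=> F0; apply: limf_einf_ge; near=> eps; apply: box_ratio_ge.
  by apply/andP; split; near: eps; [exact: nbhs_right_gt|exact: nbhs_right_lt].
by rewrite oppr0 powRr0 covering_number_ge1.
Unshelve. all: by end_near. Qed.

(** Stated for all sets of positive mass, because the modified dimensions are
    bounded below by applying it to one piece of a cover. *)
Lemma lower_density_le_box_dim G : 0 < digit_mass S G ->
  lower_density S <= lower_box_dim G.
Proof.
move=> G0; apply: lee_real_below => s sS.
have Gn := digit_mass_nonempty G0; have m0 := fine_digit_mass_gt0 G0.
have [s0|s0] := ltP s 0%R.
  by apply: le_trans (lower_box_dim_ge0 Gn); rewrite lee_fin ltW.
have c0 : (0 < fine (digit_mass S G) / 3 / 2 `^ s)%R.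
  by rewrite !divr_gt0// powR_gt0.
have [K _ SK] := lower_density_gt sS c0.
apply: limf_einf_ge; near=> eps.
have e0 : (0 < eps)%R by near: eps; exact: nbhs_right_gt.
have eK : (eps <= (2 ^+ K)^-1)%R.
  by near: eps; apply: nbhs_right_le; rewrite invr_gt0 exprn_gt0.
have e1 : (eps < 1)%R by near: eps; exact: nbhs_right_lt.
have [k [Kk ke ek]] := dyadic_scale e0 eK.
apply: box_ratio_ge; first by rewrite e0.
apply: le_trans (covering_number_digit_mass _ ek); rewrite lee_fin.
apply: (le_trans (ler_powRN_scale s0 e0 (ltW ke))).
have := SK k Kk; rewrite /= mulrAC ler_pdivlMr ?powR_gt0//.
by rewrite -[k.+1%:R]natr1 mulrDr mulr1 powRD// pnatr_eq0 implybT.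
Unshelve. all: by end_near. Qed.

Lemma upper_density_le_box_dim G : 0 < digit_mass S G ->
  upper_density S <= upper_box_dim G.
Proof.
move=> G0; apply: lee_real_below => s sS.
have m0 := fine_digit_mass_gt0 G0.
have c0 : (0 < fine (digit_mass S G) / 3)%R by rewrite divr_gt0.
apply: limf_esup_ge_frequently => A /dyadic_at_right FA.
have [k [Ak /= k0] kS] := upper_density_gt sS c0 (filterI FA (nbhs_infty_gt 0)).
exists (2 ^+ k)^-1%R => //; apply: box_ratio_ge.
  by rewrite invr_gt0 exprn_gt0//= invf_lt1 ?exprn_gt0// exprn_egt1 ?ltr1n// -lt0n.
apply: le_trans (covering_number_digit_mass _ (lexx _)); rewrite lee_fin.
by rewrite dyadic_powRN.
Qed.

Lemma lower_box_dim_digit_set_le :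
  lower_box_dim (digit_set S : set R) <= lower_density S.
Proof.
apply: lee_real_above => s sS.
apply: limf_einf_le_frequently => A /dyadic_at_right FA.
have [k [Ak /= k0] kS] := lower_density_lt sS ltr01 (filterI FA (nbhs_infty_gt 0)).
exists (2 ^+ k)^-1%R => //; apply: box_ratio_le.
  by rewrite invr_gt0 exprn_gt0//= invf_lt1 ?exprn_gt0// exprn_egt1 ?ltr1n// -lt0n.
apply: (le_trans (covering_number_digit_set_le k)); rewrite lee_fin natrX.
apply: (le_trans kS); rewrite mul1r.
by rewrite dyadic_powRN.
Qed.

(** An arbitrary small [eps] is compared with the next smaller power of [2]; the
    possible extra digit doubles the number of intervals, which the factor
    [2^-1] taken from [upper_density_lt] compensates. *)
Lemma upper_box_dim_digit_set_le :
  upper_box_dim (digit_set S : set R) <= upper_density S.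
Proof.
apply: lee_real_above => s sS.
have s0 : (0 <= s)%R by rewrite -lee_fin (le_trans (upper_density_ge0 S))// ltW.
have h0 : (0 < 2^-1 :> R)%R by [].
have [K _ SK] := upper_density_lt sS h0.
apply: limf_esup_le; near=> eps.
have e0 : (0 < eps)%R by near: eps; exact: nbhs_right_gt.
have eK : (eps <= (2 ^+ K)^-1)%R.
  by near: eps; apply: nbhs_right_le; rewrite invr_gt0 exprn_gt0.
have e1 : (eps < 1)%R by near: eps; exact: nbhs_right_lt.
have [k [Kk ke ek]] := dyadic_scale e0 eK.
apply: box_ratio_le; first by rewrite e0.
apply: (le_trans (covering_number_anti _ (ltW ke))).
apply: (le_trans (covering_number_digit_set_le _)); rewrite lee_fin natrX.
apply: le_trans (ler_scale_powRN s0 e0 ek).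
apply: (@le_trans _ _ (2 ^+ (digit_count S k).+1)%R).
  by rewrite ler_eXn2l ?ltr1n//=; case: (_ \in _); lia.
rewrite exprS -ler_pdivlMl// ; exact: SK.
Unshelve. all: by end_near. Qed.

End BoxDimensions.

(** * Hausdorff dimension *)

Section DiamPow.
Context {R : realType}.
Implicit Types (U F : set R) (s d delta eps : R).

Lemma diam_pow_ge0 s U : 0 <= diam_pow s U.
Proof. by rewrite /diam_pow; case: ifP => // _; exact: poweR_ge0. Qed.

Lemma diam_pow_set0 s : diam_pow s (set0 : set R) = 0.
Proof. by rewrite /diam_pow eqxx. Qed.

Lemma diam_pow_le s U d : (0 <= s)%R -> (0 <= d)%R -> diam U <= d%:E ->
  diam_pow s U <= (d `^ s)%:E.
Proof.
move=> s0 d0 Ud; rewrite /diam_pow; case: ifP => _.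
  by rewrite lee_fin powR_ge0.
rewrite -poweR_EFin; apply: gt0_ler_poweR => //.
  by rewrite in_itv/= diam_ge0 leey.
by rewrite in_itv/= leey lee_fin d0.
Qed.

End DiamPow.

Section Hausdorff.
Context {R : realType}.
Implicit Types (U F : set R) (s d delta eps : R).

Lemma hausdorff_content_ge0 s delta F : 0 <= hausdorff_content s delta F.
Proof.
apply: le_ereal_inf_tmp => _ [U _ <-]; apply: nneseries_ge0 => i _ _.
exact: diam_pow_ge0.
Qed.

(** The contents grow as [delta] decreases, so the limit is a supremum. *)
Lemma hausdorff_measureE s F : hausdorff_measure s F =
  ereal_sup [set hausdorff_content s delta F | delta in [set` `]0%R, +oo[]].
Proof.
apply/cvg_lim => //; apply: nonincreasing_at_right_cvge => // d d' _ _ dd'.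
apply: le_ereal_inf_tmp => _ [U [Ud FU] <-]; apply: ereal_inf_lbound.
exists U => //; split => // i; apply: (le_trans (Ud i)).
by rewrite lee_fin.
Qed.

Lemma hausdorff_content_cover s delta eps F n (U : 'I_n -> set R) :
  (0 <= s)%R -> (0 <= eps <= delta)%R ->
  (forall i, diam (U i) <= eps%:E) -> F `<=` \bigcup_i U i ->
  hausdorff_content s delta F <= (n%:R * eps `^ s)%:E.
Proof.
move=> s0 /andP[e0 ed] Ue FU; pose V k := if insub k is Some i then U i else set0.
have Ve k : diam (V k) <= eps%:E.
  by rewrite /V; case: insub => // ; rewrite diam_set0 lee_fin.
apply: (@le_trans _ _ (\sum_(k <oo) diam_pow s (V k))).
  apply: ereal_inf_lbound; exists V => //; split => [k|x /FU[i _ Ux]].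
    by apply: (le_trans (Ve k)); rewrite lee_fin.
  by exists (val i) => //; rewrite /V valK.
rewrite (nneseries_split _ n) => [|k _]; last exact: diam_pow_ge0.
rewrite eseries0 ?adde0 => [|k nk _]; last first.
  by rewrite /V insubF ?diam_pow_set0// ltnNge -(add0n n) nk.
rewrite add0n big_mkord; apply: (@le_trans _ _ (\sum_(k < n) (eps `^ s)%:E)).
  by apply: lee_sum => k _; exact: diam_pow_le.
by rewrite sumEFin lee_fin sumr_const card_ord mulr_natl.
Qed.

Variable S : set nat.

Lemma hausdorff_dim_digit_set_le :
  hausdorff_dim (digit_set S : set R) <= lower_density S.
Proof.
apply: lee_real_above => s sS.
have s0 : (0 <= s)%R by rewrite -lee_fin (le_trans (lower_density_ge0 S))// ltW.
rewrite /hausdorff_dim; apply: ereal_inf_lbound => /=; exists s => //; split => //.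
apply/eqP; rewrite eq_le; apply/andP; split; last first.
  rewrite hausdorff_measureE; apply: le_trans (ereal_sup_ubound _); last first.
    by exists 1%R => //=; rewrite in_itv/= ltr01.
  exact: hausdorff_content_ge0.
rewrite hausdorff_measureE; apply: ge_ereal_sup => _ [d /= +] <-.
rewrite in_itv/= andbT => d0; apply/lee_addgt0Pr => e e0; rewrite add0e.
have Ad : \forall k \near \oo, ((2 ^+ k)^-1 <= d)%R.
  by apply: (@dyadic_at_right _ [set x | (x <= d)%R]); exact: nbhs_right_le.
have [k kd kS] := lower_density_lt sS e0 Ad.
have [U [Uk XU]] := @digit_set_dyadic_cover R S k.
have ekd : (0 <= ((2 ^+ k)^-1 : R) <= d)%R.
  by rewrite kd andbT invr_ge0 exprn_ge0.
apply: (le_trans (hausdorff_content_cover s0 ekd Uk XU)).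
rewrite lee_fin natrX; apply: (le_trans (ler_wpM2r (powR_ge0 _ _) kS)).
rewrite -(opprK s) dyadic_powRN opprK -mulrA -powRD ?pnatr_eq0 ?implybT//.
by rewrite mulNr subrr powRr0 mulr1.
Qed.

(** A set of diameter about [2^-k] has mass at most [3 / 2 ^+ digit_count S k],
    and below the lower density [digit_count S k] exceeds [s * k] at all fine
    scales. *)
Lemma digit_mass_diam_pow s : (0 <= s)%R -> s%:E < lower_density S ->
  exists K, forall U : set R, diam U <= ((2 ^+ K)^-1)%R%:E ->
    digit_mass S U <= (3 * 2 `^ s)%:E * diam_pow s U.
Proof.
move=> s0 sS; have [K _ SK] := lower_density_gt sS ltr01; exists K => U UK.
have C0 : (0 < 3 * 2 `^ s :> R)%R by rewrite mulr_gt0// powR_gt0.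
(* The bound is proved for every upper bound r > 0 of the diameter, so that the
   case of diameter 0 follows by letting r tend to 0. *)
have massU r : (0 < r <= (2 ^+ K)^-1)%R -> diam U <= r%:E ->
    digit_mass S U <= (3 * 2 `^ s * r `^ s)%:E.
  move=> /andP[r0 rK] Ur; have [k [Kk kr rk]] := dyadic_scale r0 rK.
  have Uk : diam U <= ((2 ^+ k)^-1)%R%:E by apply: (le_trans Ur); rewrite lee_fin.
  apply: (le_trans (digit_mass_diam S Uk)); rewrite lee_fin.
  have := ler_powRN_scale s0 r0 (ltW kr); rewrite powRN -[k.+1%:R]natr1.
  rewrite mulrDr mulr1 powRD ?pnatr_eq0 ?implybT// => rs.
  have /= := SK k Kk; rewrite mul1r => ks.
  rewrite -mulrA ler_pM2l//.
  have a0 : (0 < 2 ^+ digit_count S k :> R)%R by rewrite exprn_gt0.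
  have p0 : (0 < r `^ s)%R by rewrite powR_gt0.
  have q0 : (0 < 2 `^ s :> R)%R by rewrite powR_gt0.
  rewrite -[leLHS]invrK -[leRHS]invrK lef_pV2 ?posrE ?invrK ?invr_gt0 ?mulr_gt0//.
  rewrite invfM ler_pdivrMl// (le_trans rs)// mulrC ler_pM2l//.
have [->|U0] := eqVneq U set0; first by rewrite digit_mass0 diam_pow_set0 mule0.
have := diam_ge0 U; rewrite /diam_pow (negbTE U0).
move: UK massU; case: (diam U) => [d||]//; rewrite !lee_fin => dK massU.
rewrite le_eqVlt => /predU1P[d0|d0]; last first.
  by rewrite -EFinM; apply: massU => //; rewrite d0.
rewrite -d0 in massU *; move: s0; rewrite le_eqVlt => /predU1P[s0|s0].
  have := massU (2 ^+ K)^-1%R; rewrite -s0 !powRr0 poweRe0 mule1 mulr1; apply.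
    by rewrite lexx invr_gt0 exprn_gt0.
  by rewrite lee_fin invr_ge0 exprn_ge0.
rewrite poweR0r ?gt_eqF// mule0; apply/lee_addgt0Pr => e e0; rewrite add0e.
(* For s > 0 the power of the diameter is 0, so the mass has to vanish. *)
near (at_right (0 : R)%R) => r.
have r0 : (0 < r)%R by near: r; exact: nbhs_right_gt.
have rK : (r <= (2 ^+ K)^-1)%R.
  by near: r; apply: nbhs_right_le; rewrite invr_gt0 exprn_gt0.
have := massU r; rewrite r0 rK lee_fin => /(_ isT (ltW r0)) /le_trans; apply.
rewrite lee_fin -ler_pdivlMl//; near: r.
have /cvgrPdist_le := powR_cvg0 s0 => /(_ ((3 * 2 `^ s)^-1 * e)%R).
rewrite mulr_gt0 ?invr_gt0// => /(_ isT); apply: filterS => x.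
by rewrite sub0r normrN ger0_norm ?powR_ge0.
Unshelve. all: by end_near. Qed.

(** If [s] were below the lower density, [digit_mass_diam_pow] and the
    subadditivity of the mass would bound the sum of [diam_pow s] over any fine
    cover from below by a positive constant. *)
Lemma lower_density_le_hausdorff_dim :
  lower_density S <= hausdorff_dim (digit_set S : set R).
Proof.
apply: le_ereal_inf_tmp => _ [s [s0 Hs] <-]; rewrite leNgt; apply/negP => sS.
have [K massK] := digit_mass_diam_pow s0 sS.
have C0 : (0 < 3 * 2 `^ s :> R)%R by rewrite mulr_gt0// powR_gt0.
suff : ((3 * 2 `^ s)^-1)%:E <= hausdorff_measure s (digit_set S : set R).
  by rewrite Hs lee_fin leNgt invr_gt0 C0.
rewrite hausdorff_measureE.
apply: (le_trans _ (ereal_sup_ubound _)); last first.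
  exists (2 ^+ K)^-1%R; last reflexivity.
  by rewrite /= in_itv/= andbT invr_gt0 exprn_gt0.
apply: le_ereal_inf_tmp => _ [U [UK XU] <-].
rewrite -[leLHS]mule1 -(@digit_mass_digit_set R S) lee_pdivrMl//.
apply: (le_trans (digit_mass_sub S XU)).
rewrite -nneseriesZl => [|i _]; last exact: diam_pow_ge0.
apply: lee_nneseries => i.
  by move=> *; exact: digit_mass_ge0.
by move=> *; exact: massK.
Qed.

End Hausdorff.

(** * Packing dimension *)

Section Packing.
Context {R : realType}.
Implicit Types (U F G : set R) (s d delta eps r c : R).

Lemma diam_closed_ball c r : (0 < r)%R -> diam (closed_ball c r) = (2 * r)%:E.
Proof.
move=> r0; have d0 : (0 <= 2 * r)%R by rewrite mulr_ge0// ltW.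
apply/eqP; rewrite eq_le; apply/andP; split.
  apply/diam_leP => // x y; rewrite closed_ball_itv// /= !in_itv/=.
  by move=> /andP[? ?] /andP[? ?]; rewrite ler_norml; lra.
rewrite /diam le_max; apply/orP; right; apply: ereal_sup_ubound.
exists (c + r)%R; first by rewrite closed_ball_itv//= in_itv/=; lra.
exists (c - r)%R; first by rewrite closed_ball_itv//= in_itv/=; lra.
by rewrite (_ : c + r - (c - r) = 2 * r)%R ?ger0_norm//; lra.
Qed.

Lemma diam_pow_closed_ball s c r : (0 < r)%R ->
  diam_pow s (closed_ball c r) = ((2 * r) `^ s)%:E.
Proof.
move=> r0; rewrite /diam_pow ifF ?diam_closed_ball//.
by apply/negbTE/set0P; exists c; exact: closed_ballxx.
Qed.

Lemma packing_content_ge0 s delta F : 0 <= packing_content s delta F.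
Proof.
apply: ereal_sup_ubound => /=; exists (set0, cst 0%R, cst 0%R); last first.
  by rewrite esum_set0.
by split => //; exact: trivIset_set0.
Qed.

(** The contents shrink with [delta], so the limit is an infimum. *)
Lemma packing_premeasureE s F : packing_premeasure s F =
  ereal_inf [set packing_content s delta F | delta in [set` `]0%R, +oo[]].
Proof.
apply/cvg_lim => //; apply: nondecreasing_at_right_cvge => // d d' _ _ dd'.
apply: ge_ereal_sup => _ [[[D c] r] [Dr DD] <-]; apply: ereal_sup_ubound.
exists (D, c, r) => //; split => // i Di; have [Fc /andP[r0 rd]] := Dr i Di.
by split => //; rewrite r0 (le_trans rd).
Qed.

Lemma packing_premeasure_ge0 s F : 0 <= packing_premeasure s F.
Proof.
rewrite packing_premeasureE; apply: le_ereal_inf_tmp => _ [d _ <-].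
exact: packing_content_ge0.
Qed.

(** The constant sequence [F] is a cover whose terms all have premeasure zero. *)
Lemma packing_measure_le s F : packing_premeasure s F = 0 ->
  packing_measure s F = 0.
Proof.
move=> F0; apply/eqP; rewrite eq_le; apply/andP; split; last first.
  apply: le_ereal_inf_tmp => _ [G _ <-]; apply: nneseries_ge0 => i _ _.
  exact: packing_premeasure_ge0.
apply: ereal_inf_lbound; exists (fun=> F); first by move=> x Fx; exists 0%N.
by rewrite eseries0.
Qed.

(** Greedy choice: as long as the balls of radius [d] about the points chosen so
    far do not cover [G], another point can be added. *)
Lemma separated_or_covered G d n : (0 <= d)%R ->
  (exists s : seq R, [/\ size s = n, {in s, forall x, G x} &
     pairwise (fun x y => d < `|x - y|)%R s]) \/
  (exists m (U : 'I_m -> set R), [/\ (m <= n)%N,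
     forall i, diam (U i) <= (2 * d)%:E & G `<=` \bigcup_i U i]).
Proof.
move=> d0; elim: n => [|n [[s [sn sG sd]]|[m [U [mn Ud GU]]]]].
- by left; exists [::].
- have [[x [Gx xs]]|far] :=
    pselect (exists x, G x /\ forall y, y \in s -> (d < `|x - y|)%R).
    left; exists (x :: s); split; first by rewrite /= sn.
      by move=> y; rewrite inE => /predU1P[->|/sG].
    by rewrite /= sd andbT; apply/allP.
  right; exists (size s), (fun i => [set x | (`|nth 0%R s i - x| <= d)%R]); split.
  + by rewrite sn.
  + move=> i; apply/diam_leP => [|x y]; first by rewrite mulr_ge0.
    by rewrite /= !ler_norml => /andP[? ?] /andP[? ?]; lra.
  + move=> x Gx; apply: contrapT => xs; apply: far; exists x; split => // y ys.
    rewrite ltNge; apply/negP => xy; apply: xs.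
    have iy : (index y s < size s)%N by rewrite index_mem.
    by exists (Ordinal iy) => //=; rewrite nth_index// distrC.
- by right; exists m, U; split => //; exact: leqW.
Qed.

Lemma packing_content_separated s r delta G (xs : seq R) :
  (0 < r <= delta)%R -> {in xs, forall x, G x} ->
  pairwise (fun x y => 2 * r < `|x - y|)%R xs ->
  ((size xs)%:R * (2 * r) `^ s)%:E <= packing_content s delta G.
Proof.
move=> /andP[r0 rd] xsG sep.
have -> : ((size xs)%:R * (2 * r) `^ s)%:E =
    \esum_(i in `I_(size xs)) diam_pow s (closed_ball (nth 0%R xs i) r).
  rewrite esum_fset//; last by move=> i _; exact: diam_pow_ge0.
  rewrite -fsbig_ord.
  under eq_bigr do rewrite diam_pow_closed_ball//.
  by rewrite sumEFin sumr_const card_ord mulr_natl.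
apply: ereal_sup_ubound.
exists (`I_(size xs), nth 0%R xs, cst r) => //; split => [i /= iD|].
  by split; [apply: xsG; exact: mem_nth|rewrite r0].
move=> i j /= iD jD [x []]; rewrite !closed_ballE// /closed_ball_ /= => xi xj.
apply/eqP; apply: contrapT => /negP ij.
have far k l : (l < size xs)%N -> (k < l)%N ->
    (2 * r < `|nth 0 xs k - nth 0 xs l|)%R.
  move=> lD kl; apply: (pairwiseP 0%R sep) => //.
  by rewrite inE (ltn_trans kl).
have : (2 * r < `|nth 0 xs i - nth 0 xs j|)%R.
  have [ij'|ji|] := ltngtP i j; [exact: far|by rewrite distrC; exact: far|].
  by move/eqP; rewrite (negbTE ij).
rewrite ltNge => /negP; apply; move: xi xj; rewrite !ler_norml.
by move=> /andP[? ?] /andP[? ?]; lra.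
Qed.

(** A bound on the packing content bounds the size of [2 * r]-separated sets,
    since the balls of radius [r] about their points are disjoint; by
    [separated_or_covered] it bounds covering numbers. *)
Lemma packing_content_cover s r delta G : (0 < r <= delta)%R ->
  packing_content s delta G < 1 ->
  exists n (U : 'I_n -> set R), [/\ (n%:R <= (2 * r) `^ (- s) + 1)%R,
    forall i, diam (U i) <= (4 * r)%:E & G `<=` \bigcup_i U i].
Proof.
move=> rd P1; have r0 : (0 < r)%R by case/andP: rd.
have p0 : (0 < (2 * r) `^ (- s))%R by rewrite powR_gt0// mulr_gt0.
have d0 : (0 <= 2 * r)%R by rewrite mulr_ge0// ltW.
have [] := separated_or_covered G (Num.trunc ((2 * r) `^ (- s))).+1 d0.
  move=> [xs [xsn xsG sep]].
  have := le_lt_trans (packing_content_separated s rd xsG sep) P1.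
  rewrite lte_fin xsn ltNge -ler_pdivrMr ?powR_gt0 ?mulr_gt0// div1r -powRN.
  by rewrite ltW// truncnS_gt.
move=> [n [U [ns Ud GU]]]; exists n, U; split => //; last first.
  by move=> i; rewrite (_ : 4 * r = 2 * (2 * r))%R//; lra.
apply: (@le_trans _ _ (Num.trunc ((2 * r) `^ (- s))).+1%:R%R).
  by rewrite ler_nat.
by rewrite -natr1 lerD2r truncn_le ltW.
Qed.

End Packing.

Section PackingDigitSet.
Context {R : realType}.
Variable S : set nat.
Implicit Types (s t r x delta : R).

(** The set of parameters sent into a ball of radius about [2^-n] centred in
    the digit set contains a dyadic interval of length [2^-(digit_count S n)]. *)
Lemma ball_digit_interval t : (0 <= t)%R -> upper_density S < t%:E ->
  exists K, forall x r, digit_set S x -> (0 < r <= (2 ^+ K)^-1)%R ->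
  exists I : set R, [/\ measurable I, I `<=` `[0%R, 1%R[%classic,
    forall u, I u -> closed_ball x r (spread_point S u) &
    ((2 * r) `^ t)%:E <= (4 `^ t)%:E * lebesgue_measure I].
Proof.
move=> t0 St; have [K _ SK] := upper_density_lt St ltr01; exists K => x r Xx.
move=> /andP[r0 rK]; have [k [Kk kr rk]] := dyadic_scale r0 rK.
have [q [qn _ qx]] := digit_set_cell k.+1 Xx.
set a := digit_count S k.+1 in qn qx *.
have a0 : (0 < 2 ^+ a :> R)%R by rewrite exprn_gt0.
exists [set` `[(q%:R / 2 ^+ a)%R, (q.+1%:R / 2 ^+ a)%R[]; split => //.
- move=> u /=; rewrite !in_itv/= => /andP[qu uq].
  apply/andP; split; first by apply: le_trans qu; rewrite divr_ge0// ltW.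
  apply: (lt_le_trans uq).
  by rewrite ler_pdivrMr// mul1r -natrX ler_nat.
- move=> u /=; rewrite in_itv/= => /qx ux.
  by rewrite closed_ballE// /closed_ball_/= distrC (le_trans ux)// ltW.
rewrite lebesgue_measure_itv/= lte_fin ltr_pM2r ?invr_gt0// ltr_nat ltnSn.
rewrite -EFinB -EFinM lee_fin -mulrBl -natrB// subSnn div1r.
have ka : (2 ^+ a <= 2 `^ (t * k.+1%:R) :> R)%R.
  by have := SK k.+1 (leqW Kk); rewrite mul1r.
apply: (@le_trans _ _ ((4 * (2 ^+ k.+1)^-1) `^ t))%R.
  have rk2 : (2 * r <= 4 * (2 ^+ k.+1)^-1)%R by rewrite exprS invfM; lra.
  have r2 : (0 <= 2 * r)%R by rewrite mulr_ge0// ltW.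
  by apply: ge0_ler_powR; rewrite // nnegrE // (le_trans r2).
rewrite powRM ?invr_ge0 ?exprn_ge0// ler_pM2l ?powR_gt0//.
rewrite -[X in (_ `^ X <= _)%R]opprK dyadic_powRN mulNr powRN.
by rewrite lef_pV2 ?posrE ?powR_gt0.
Qed.

(** The parameters sent into disjoint balls are disjoint, so the dyadic
    intervals of [ball_digit_interval] have total length at most 1. This bounds
    the sum of the [t]-th powers of the diameters; the surplus exponent [s - t]
    contributes a power of [delta]. *)
Lemma packing_content_digit_set t s : (0 <= t)%R -> (t <= s)%R ->
  upper_density S < t%:E -> exists K, forall delta,
    (0 < delta <= (2 ^+ K)^-1)%R ->
    packing_content s delta (digit_set S : set R) <=
    (4 `^ t * (2 * delta) `^ (s - t))%:E.
Proof.
move=> t0 ts St; have [K ball] := ball_digit_interval t0 St; exists K => delta.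
move=> /andP[delta0 dK].
apply: ge_ereal_sup => _ [[[D c] r] [DX Ddisj] <-].
(* Outside D the interval is arbitrary; the empty set is measurable. *)
have /choice[I DI] : forall i, exists I : set R, measurable I /\ (D i ->
    [/\ I `<=` `[0%R, 1%R[%classic,
    forall u, I u -> closed_ball (c i) (r i) (spread_point S u) &
    ((2 * r i) `^ t)%:E <= (4 `^ t)%:E * lebesgue_measure I]).
  move=> i; have [Di|nDi] := pselect (D i); last by exists set0.
  have [Xc /andP[r0 rd]] := DX i Di.
  have [|I [mI I01 Ib Im]] := ball (c i) (r i) Xc.
    by rewrite r0 (le_trans rd).
  by exists I.
have C0 : (0 <= 4 `^ t * (2 * delta) `^ (s - t))%R.
  by rewrite mulr_ge0// powR_ge0.
apply: ge_ereal_sup => _ [A [finA AD] <-].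
have ballA i : A i -> diam_pow s (closed_ball (c i) (r i)) <=
    (4 `^ t * (2 * delta) `^ (s - t))%:E * lebesgue_measure (I i).
  move=> /AD Di; have [_ /(_ Di)[_ _ Im]] := DI i.
  have [_ /andP[r0 rd]] := DX i Di.
  have r2 : (0 < 2 * r i)%R by rewrite mulr_gt0.
  rewrite diam_pow_closed_ball//.
  have -> : ((2 * r i) `^ s = (2 * r i) `^ t * (2 * r i) `^ (s - t))%R.
    by rewrite -powRD ?[(2 * r i)%R == _]gt_eqF ?implybT// addrC subrK.
  rewrite !EFinM muleAC; apply: lee_pmul; rewrite ?lee_fin ?powR_ge0//.
  apply: ge0_ler_powR; rewrite ?nnegrE ?subr_ge0 ?(ltW r2)//.
    by rewrite mulr_ge0// ltW.
  by rewrite ler_pM2l.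
apply: (@le_trans _ _ (\sum_(i \in A)
    (4 `^ t * (2 * delta) `^ (s - t))%:E * lebesgue_measure (I i))).
  by apply: lee_fsum.
rewrite -ge0_mule_fsumr//.
rewrite -[leRHS]mule1; apply: lee_wpmul2l; first by rewrite lee_fin.
rewrite -measure_fin_bigcup//.
- apply: (@le_trans _ _ (lebesgue_measure `[0%R, 1%R[%classic)).
    apply: lebesgue_outer_le => u [i /AD Di]; have [_ /(_ Di)[+ _ _]] := DI i.
    exact.
  by rewrite lebesgue_measure_itv /= lte_fin ltr01 sube0.
- move=> i j /AD Di /AD Dj [u [Iiu Iju]]; apply: Ddisj => //.
  exists (spread_point S u); split.
    by have [_ /(_ Di)[_ + _]] := DI i; exact.
  by have [_ /(_ Dj)[_ + _]] := DI j; exact.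
- by move=> i _; have [] := DI i.
Qed.

Lemma packing_dim_digit_set_le :
  packing_dim (digit_set S : set R) <= upper_density S.
Proof.
apply: lee_real_above => s /lte_real_dense[t /andP[St]]; rewrite lte_fin => ts.
have t0 : (0 <= t)%R by rewrite -lee_fin (le_trans (upper_density_ge0 S))// ltW.
rewrite /packing_dim; apply: ereal_inf_lbound => /=; exists s => //; split.
  by rewrite (le_trans t0)// ltW.
have [K XK] := packing_content_digit_set t0 (ltW ts) St.
apply: packing_measure_le; apply/eqP.
rewrite eq_le packing_premeasure_ge0 andbT packing_premeasureE.
apply/lee_addgt0Pr => e e0; rewrite add0e.
have ts0 : (0 < s - t)%R by rewrite subr_gt0.
have C0 : (0 < 4 `^ t * 2 `^ (s - t) :> R)%R by rewrite mulr_gt0// powR_gt0.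
near (at_right (0 : R)%R) => d.
have d0 : (0 < d)%R by near: d; exact: nbhs_right_gt.
apply: (@le_trans _ _ (packing_content s d (digit_set S : set R))).
  by apply: ereal_inf_lbound; exists d => //=; rewrite in_itv/= d0.
apply: (le_trans (XK d _)).
  by rewrite d0/=; near: d; apply: nbhs_right_le; rewrite invr_gt0 exprn_gt0.
rewrite lee_fin powRM ?(ltW d0)// mulrA -ler_pdivlMl//; near: d.
have /cvgrPdist_le := powR_cvg0 ts0 => /(_ ((4 `^ t * 2 `^ (s - t))^-1 * e)%R).
rewrite mulr_gt0 ?invr_gt0// => /(_ isT); apply: filterS => x.
by rewrite sub0r normrN ger0_norm ?powR_ge0.
Unshelve. all: by end_near. Qed.

(** A cover by sets of small premeasure has a piece of positive mass. The
    packing content of that piece bounds its covering numbers from above and its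
    mass bounds them from below; at infinitely many scales the bounds
    conflict. *)
Lemma upper_density_le_packing_dim :
  upper_density S <= packing_dim (digit_set S : set R).
Proof.
apply: le_ereal_inf_tmp => _ [s [s0 Ps] <-]; rewrite leNgt; apply/negP => sS.
have : packing_measure s (digit_set S : set R) < 1 by rewrite Ps lte_fin.
move=> /ereal_inf_lt[_ [G XG <-]] G1.
have [i Gi0] := cover_digit_mass_gt0 XG.
have : packing_premeasure s (G i) < 1.
  apply: le_lt_trans G1; rewrite (@nneseriesD1 _ _ i)//; last first.
    by move=> j _; exact: packing_premeasure_ge0.
  by rewrite leeDl// nneseries_ge0// => j _ _; exact: packing_premeasure_ge0.
rewrite packing_premeasureE => /ereal_inf_lt[_ [d /= + <-] dG].
rewrite in_itv/= andbT => d0.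
set m := fine (digit_mass S (G i)).
have m0 : (0 < m)%R by exact: fine_digit_mass_gt0.
have q0 : (0 < 2 `^ s :> R)%R by rewrite powR_gt0.
have c0 : (0 < m / 3 / (4 * 2 `^ s))%R by rewrite !divr_gt0// mulr_gt0.
have Ad : \forall k \near \oo, ((2 ^+ k)^-1 <= d)%R.
  by apply: (@dyadic_at_right _ [set x | (x <= d)%R]); exact: nbhs_right_le.
have [k kd kS] := upper_density_gt sS c0 Ad.
have k0 : (0 < (2 ^+ k)^-1 :> R)%R by rewrite invr_gt0 exprn_gt0.
have rd : (0 < ((2 ^+ k)^-1 / 4 : R) <= d)%R.
  by apply/andP; split; move: kd => /=; lra.
have [n [U [nle Ud GU]]] := packing_content_cover rd dG.
have Uk j : diam (U j) <= ((2 ^+ k)^-1)%R%:E.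
  by apply: (le_trans (Ud j)); rewrite lee_fin; lra.
have := covering_digit_mass S Uk GU; rewrite -/m leNgt => /negP; apply.
apply: (le_lt_trans nle).
rewrite (_ : 2 * ((2 ^+ k)^-1 / 4) = (2 ^+ k.+1)^-1)%R; last first.
  by rewrite exprS invfM; lra.
rewrite dyadic_powRN -[k.+1%:R]natr1 mulrDr mulr1 powRD; last first.
  by rewrite pnatr_eq0 implybT.
have one s' : (0 <= s')%R -> (1 <= 2 `^ s' :> R)%R.
  by move=> ?; rewrite -[leLHS](powRr0 2) ler_powR ?ler1n.
have ks1 := one _ (mulr_ge0 s0 (ler0n R k)); have s1 := one _ s0.
have : (2 `^ (s * k%:R) * (4 * 2 `^ s) <= m / 3 * 2 ^+ digit_count S k)%R.
  by rewrite -ler_pdivlMr ?mulr_gt0// mulrAC.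
have : (1 <= 2 `^ (s * k%:R) * 2 `^ s :> R)%R by rewrite -[leLHS]mulr1 ler_pM.
lra.
Qed.

End PackingDigitSet.

(** * Modified box dimensions and the theorem *)

Section ModifiedBoxDimensions.
Context {R : realType}.
Variable S : set nat.

Lemma bounded_covers_digit_set :
  bounded_covers (digit_set S : set R) (fun=> digit_set S).
Proof.
split=> [i|x Xx]; last by exists 0%N.
split; first by exists (spread_point S 0%R); exact: spread_point_in.
exists 1%R; split; first exact: num_real.
move=> M M1 x /(digit_set_cell 0)[[|q] [//= _ + _]].
by rewrite expr0 !divr1 => /andP[x0 x1]; rewrite ger0_norm// (le_trans x1)// ltW.
Qed.

Lemma modified_lower_box_dim_digit_set_le :
  modified_lower_box_dim (digit_set S : set R) <= lower_box_dim (digit_set S : set R).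
Proof.
apply: (le_trans (ereal_inf_lbound _)).
  by exists (fun=> digit_set S); first exact: bounded_covers_digit_set.
by apply: ge_ereal_sup => _ [i _ <-].
Qed.

Lemma modified_upper_box_dim_digit_set_le :
  modified_upper_box_dim (digit_set S : set R) <= upper_box_dim (digit_set S : set R).
Proof.
apply: (le_trans (ereal_inf_lbound _)).
  by exists (fun=> digit_set S); first exact: bounded_covers_digit_set.
by apply: ge_ereal_sup => _ [i _ <-].
Qed.

Lemma lower_density_le_modified_box_dim :
  lower_density S <= modified_lower_box_dim (digit_set S : set R).
Proof.
apply: le_ereal_inf_tmp => _ [G [_ /cover_digit_mass_gt0[i Gi]] <-].
apply: (le_trans (lower_density_le_box_dim Gi)).
by apply: ereal_sup_ubound; exists i.
Qed.

Lemma upper_density_le_modified_box_dim :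
  upper_density S <= modified_upper_box_dim (digit_set S : set R).
Proof.
apply: le_ereal_inf_tmp => _ [G [_ /cover_digit_mass_gt0[i Gi]] <-].
apply: (le_trans (upper_density_le_box_dim Gi)).
by apply: ereal_sup_ubound; exists i.
Qed.

End ModifiedBoxDimensions.

Theorem theorem2p5 (R : realType) (S : set nat)
    (hS : S `<=` [set n | (1 <= n)%N]) :
  let X : set R := digit_set S in
  [/\ hausdorff_dim X = modified_lower_box_dim X,
      modified_lower_box_dim X = lower_box_dim X &
      lower_box_dim X = lower_density S] /\
  [/\ packing_dim X = modified_upper_box_dim X,
      modified_upper_box_dim X = upper_box_dim X &
      upper_box_dim X = upper_density S].
Proof.
move=> X; rewrite /X.
have lB := @lower_box_dim_digit_set_le R S.
have uB := @upper_box_dim_digit_set_le R S.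
have lM := le_trans (@modified_lower_box_dim_digit_set_le R S) lB.
have uM := le_trans (@modified_upper_box_dim_digit_set_le R S) uB.
have Ml := @lower_density_le_modified_box_dim R S.
have Mu := @upper_density_le_modified_box_dim R S.
have Bl := le_trans Ml (@modified_lower_box_dim_digit_set_le R S).
have Bu := le_trans Mu (@modified_upper_box_dim_digit_set_le R S).
have -> : hausdorff_dim (digit_set S : set R) = lower_density S.
  by apply: le_anti; rewrite hausdorff_dim_digit_set_le lower_density_le_hausdorff_dim.
have -> : packing_dim (digit_set S : set R) = upper_density S.
  by apply: le_anti; rewrite packing_dim_digit_set_le upper_density_le_packing_dim.
have -> : modified_lower_box_dim (digit_set S : set R) = lower_density S.
  by apply: le_anti; rewrite lM Ml.
have -> : modified_upper_box_dim (digit_set S : set R) = upper_density S.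
  by apply: le_anti; rewrite uM Mu.
have -> : lower_box_dim (digit_set S : set R) = lower_density S.
  by apply: le_anti; rewrite lB Bl.
have -> : upper_box_dim (digit_set S : set R) = upper_density S.
  by apply: le_anti; rewrite uB Bu.
by [].
Qed.
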